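(* Let $\delta\in\mathbb{C}$, $\delta\neq 1$, and let $(L,\vdash,\dashv)$ be a $\delta$-Lie dialgebra over $\mathbb{C}$. Regard $L$ as an ordinary algebra with the single multiplication $xy:=x\dashv y$ (which determines the dialgebra, since $x\vdash y=-y\dashv x$). Then: (1) if $\delta\neq-\tfrac12$, this algebra is $2$-step nilpotent; (2) if $\delta=-\tfrac12$, this algebra is antiassociative and anti-right-commutative.
   Context: A $\delta$-Lie dialgebra is a complex vector space $L$ with two bilinear operations $\vdash,\dashv$ satisfying, for all $x,y,z\in L$: $x\vdash y=-\,y\dashv x$; $x\dashv(y\vdash z)=x\dashv(y\dashv z)$; $(x\vdash y)\vdash z=(x\dashv y)\vdash z$; $x\dashv(y\dashv z)=\delta\big((x\dashv y)\dashv z+y\vdash(x\dashv z)\big)$; $x\vdash(y\dashv z)=\delta\big((x\vdash y)\dashv z+y\dashv(x\dashv z)\big)$; $x\vdash(y\vdash z)=\delta\big((x\vdash y)\vdash z+y\vdash(x\vdash z)\big)$. An algebra (complex vector space with a bilinear multiplication) is $2$-step nilpotent if $(xy)z=0$ and $x(yz)=0$ for all $x,y,z$; antiassociative if $(xy)z=-x(yz)$ for all $x,y,z$; anti-right-commutative if $(xy)z=-(xz)y$ for all $x,y,z$. *)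

(* Defs.v *)
From mathcomp Require Import all_boot all_algebra.
From mathcomp Require Import reals complex.

Set Implicit Arguments.
Unset Strict Implicit.
Unset Printing Implicit Defensive.

Import GRing.Theory.
Local Open Scope ring_scope.

Section DeltaLieDialgebra.

Context (K : fieldType) (L : lmodType K).
Implicit Types x y z : L.

(* [vdash x y] is x ⊢ y and [dashv x y] is x ⊣ y. *)
Record is_delta_Lie_dialgebra (delta : K)
    (vdash dashv : {bilinear L -> L -> L}) : Prop := IsDeltaLieDialgebra {
  vdash_dashv : forall x y, vdash x y = - dashv y x;
  dashv_bar : forall x y z, dashv x (vdash y z) = dashv x (dashv y z);
  vdash_bar : forall x y z, vdash (vdash x y) z = vdash (dashv x y) z;
  dashv_Leibniz : forall x y z,
    dashv x (dashv y z)
      = delta *: (dashv (dashv x y) z + vdash y (dashv x z));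
  vdash_dashv_Leibniz : forall x y z,
    vdash x (dashv y z)
      = delta *: (dashv (vdash x y) z + dashv y (dashv x z));
  vdash_Leibniz : forall x y z,
    vdash x (vdash y z)
      = delta *: (vdash (vdash x y) z + vdash y (vdash x z))
}.

Definition two_step_nilpotent (mul : {bilinear L -> L -> L}) : Prop :=
  forall x y z, mul (mul x y) z = 0 /\ mul x (mul y z) = 0.

Definition antiassociative (mul : {bilinear L -> L -> L}) : Prop :=
  forall x y z, mul (mul x y) z = - mul x (mul y z).

Definition anti_right_commutative (mul : {bilinear L -> L -> L}) : Prop :=
  forall x y z, mul (mul x y) z = - mul (mul x z) y.

End DeltaLieDialgebra.

(* Main.v *)
Require Import Defs.
From mathcomp Require Import all_boot all_algebra ring.
From mathcomp Require Import reals complex.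

(** Every identity of a delta-Lie dialgebra, once [vdash x y] is replaced by
    [- dashv y x], relates only the three products
      [P = (xy)z],  [Q = (xz)y],  [M = x(yz) = - x(zy)],
    the last equality being the bar identity ([dashv_right_anticomm]).  The
    Leibniz identities read [M = delta (P - Q)] and [P = delta (M + Q)]; since
    exchanging [y] and [z] swaps [P] with [Q] and negates [M], also
    [Q = delta (P - M)].  Adding the last two gives
    [(1 - delta) (P + Q) = 0], hence [Q = - P] when [delta] is not [1]: this is
    anti-right-commutativity.  Then [M = 2 delta P], and substituting both in
    [P = delta (M + Q)] leaves [(1 - delta) (1 + 2 delta) P = 0].  So either
    [1 + 2 delta = 0], and [M = - P] is antiassociativity, or [P = M = 0]. *)

Set Implicit Arguments.
Unset Strict Implicit.
Unset Printing Implicit Defensive.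

Import GRing.Theory Num.Theory.
Local Open Scope ring_scope.

Section DashvMultiplication.

Context (K : fieldType) (L : lmodType K) (delta : K).
Context (vdash dashv : {bilinear L -> L -> L}).
Context (L_dialgebra : is_delta_Lie_dialgebra delta vdash dashv).
Implicit Types x y z : L.

Lemma dashv_right_anticomm x y z :
  dashv x (dashv z y) = - dashv x (dashv y z).
Proof.
by rewrite -(dashv_bar L_dialgebra x y z) (vdash_dashv L_dialgebra) linearNr
  opprK.
Qed.

Lemma dashv_assoc_Leibniz x y z :
  dashv x (dashv y z)
    = delta *: (dashv (dashv x y) z - dashv (dashv x z) y).
Proof.
by rewrite {1}(dashv_Leibniz L_dialgebra) (vdash_dashv L_dialgebra y).
Qed.

(** The Leibniz identity for [vdash] alone, taken at [(z, y, x)]: passing to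
    [dashv] reverses every product. *)
Lemma dashv_right_Leibniz x y z :
  dashv (dashv x y) z
    = delta *: (dashv x (dashv y z) + dashv (dashv x z) y).
Proof.
have := vdash_Leibniz L_dialgebra z y x.
rewrite !(vdash_dashv L_dialgebra) !(linearNl, linearNr) !opprK => ->.
by [].
Qed.

Context (delta_neq1 : delta != 1).

(** Adding [dashv_right_Leibniz] to its copy with [y] and [z] exchanged cancels
    the products [x(yz)] and [x(zy)], so the sum of the two left sides is fixed
    by [delta], hence zero. *)
Lemma dashv_anti_right_commutative : anti_right_commutative dashv.
Proof.
move=> x y z; apply/eqP; rewrite -addr_eq0.
have fixed : dashv (dashv x y) z + dashv (dashv x z) y
    = delta *: (dashv (dashv x y) z + dashv (dashv x z) y).
  rewrite [X in X + _ = _]dashv_right_Leibniz.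
  rewrite [X in _ + X = _]dashv_right_Leibniz -scalerDr.
  by rewrite (dashv_right_anticomm x y z) addrACA subrr add0r addrC.
have : (1 - delta) *: (dashv (dashv x y) z + dashv (dashv x z) y) = 0.
  by rewrite scalerBl scale1r -fixed subrr.
by move/eqP; rewrite scaler_eq0 subr_eq0 eq_sym (negPf delta_neq1).
Qed.

(** Anti-right-commutativity collapses the difference in
    [dashv_assoc_Leibniz] to twice one product.  Both cases of the theorem rest
    on this: [x(yz)] vanishes with [(xy)z], and is its opposite when
    [2 * delta = - 1]. *)
Lemma dashv_assocE x y z :
  dashv x (dashv y z) = (2 * delta) *: dashv (dashv x y) z.
Proof.
rewrite dashv_assoc_Leibniz (dashv_anti_right_commutative x z y) opprK.
by rewrite -mulr2n mulr_natl -scalerMnl scalerMnr.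
Qed.

(** With [(xz)y] and [x(yz)] both multiples of [(xy)z], the identity
    [dashv_right_Leibniz] becomes
    [(1 - delta) (1 + 2 delta) ((xy)z) = 0]. *)
Lemma dashv_two_step_nilpotent :
  1 + 2 * delta != 0 -> two_step_nilpotent dashv.
Proof.
move=> delta_neq x y z.
suff P0 : dashv (dashv x y) z = 0 by rewrite dashv_assocE P0 scaler0.
apply/eqP; have := dashv_right_Leibniz x y z.
rewrite dashv_assocE (dashv_anti_right_commutative x z y).
rewrite -[X in _ - X]scale1r -scalerBl scalerA.
move/eqP; rewrite -subr_eq0 -{1}[dashv (dashv x y) z]scale1r -scalerBl.
have -> : 1 - delta * (2 * delta - 1) = (1 - delta) * (1 + 2 * delta).
  by ring.
by rewrite scaler_eq0 mulf_eq0 subr_eq0 eq_sym (negPf delta_neq1)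
  (negPf delta_neq).
Qed.

Lemma dashv_antiassociative : 1 + 2 * delta = 0 -> antiassociative dashv.
Proof.
move=> /eqP; rewrite addrC addr_eq0 => /eqP delta2 x y z.
by rewrite dashv_assocE delta2 scaleN1r opprK.
Qed.

End DashvMultiplication.

Theorem theorem6 (R : realType) (delta : R[i]) (L : lmodType R[i])
    (vdash dashv : {bilinear L -> L -> L}) :
  delta <> 1 ->
  is_delta_Lie_dialgebra delta vdash dashv ->
  (delta <> - (1 / 2) -> two_step_nilpotent dashv) /\
  (delta = - (1 / 2) ->
     antiassociative dashv /\ anti_right_commutative dashv).
Proof.
move=> /eqP delta_neq1 L_dialgebra.
have two_neq0 : (2 : R[i]) != 0 by rewrite pnatr_eq0.
split=> [delta_neq | delta_eq].
  apply: (dashv_two_step_nilpotent L_dialgebra delta_neq1).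
  apply: contra_notN delta_neq; rewrite addrC addr_eq0 => /eqP delta2.
  by apply: (mulfI two_neq0); rewrite delta2 mulrN mul1r mulfV.
split; last exact: (dashv_anti_right_commutative L_dialgebra delta_neq1).
apply: (dashv_antiassociative L_dialgebra delta_neq1).
by rewrite delta_eq mulrN mul1r mulfV // subrr.
Qed.
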